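(* Let $\mathcal L$ be a 2-z-exact 2-category and $f\colon A\to B$ a 1-cell. If $f$ factors, up to an invertible 2-cell, as a normal 2-epimorphism $e\colon A\to I$ followed by a normal 2-monomorphism $m\colon I\to B$, then this factorisation is unique up to equivalence (that is, for any other such factorisation $f\cong m_1\circ e_1$ through an object $I_1$ there is an equivalence $t\colon I\to I_1$ with $t\circ e\cong e_1$ and $m_1\circ t\cong m$). If $f$ further factors, up to an invertible 2-cell, as a 2-epimorphism $e'\colon A\to I'$ followed by a 2-monomorphism $m'\colon I'\to B$, then necessarily $e'$ is a normal 2-epimorphism and $m'$ is a normal 2-monomorphism.
   Context: 2-categories are strict. For 1-cells, $\cong$ means that there is an invertible 2-cell between them. A bizero object of a 2-category $\mathcal L$ is an object $0$ such that for every object $A$ the hom-categories $\mathcal L(A,0)$ and $\mathcal L(0,A)$ are equivalent to the terminal category. A 1-cell is null if it factors through $0$; $f\cong 0$ means that $f$ is isomorphic to a null 1-cell. The bizero object is strong if between any two parallel 1-cells that factor through $0$ there is exactly one 2-cell. A 2-monomorphism is a 1-cell $f\colon A\to B$ such that for every object $Z$ the functor $f\circ(-)\colon\mathcal L(Z,A)\to\mathcal L(Z,B)$ is fully faithful. A 2-epimorphism is a 1-cell $f\colon A\to B$ such that for every $Z$ the functor $(-)\circ f\colon\mathcal L(B,Z)\to\mathcal L(A,Z)$ is fully faithful. In a 2-category with a strong bizero object, a 2-kernel of $f\colon A\to B$ is a 1-cell $k\colon K\to A$ with an invertible 2-cell $f\circ k\cong 0$ such that (1) for every $z\colon Z\to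 A$ with $f\circ z\cong0$ there is $u\colon Z\to K$ with $k\circ u\cong z$; (2) for all $u,v\colon Z\to K$ and every 2-cell $\lambda\colon k\circ u\Rightarrow k\circ v$ there is a unique 2-cell $\mu\colon u\Rightarrow v$ whose whiskering with $k$ is $\lambda$. 2-cokernels are defined dually. A 2-z-exact 2-category is a 2-category with a strong bizero object having all 2-kernels and all 2-cokernels. A normal 2-monomorphism is a 1-cell which is a 2-kernel of some 1-cell; a normal 2-epimorphism is a 1-cell which is a 2-cokernel of some 1-cell. *)

(* Defs.v *)
Set Implicit Arguments.
Unset Strict Implicit.
Unset Printing Implicit Defensive.

Declare Scope cat_scope.
Delimit Scope cat_scope with cat.
Local Open Scope cat_scope.

Record category := Category {
  obj :> Type;
  mor : obj -> obj -> Type;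
  idm : forall x, mor x x;
  comp : forall x y z, mor y z -> mor x y -> mor x z;
  comp_idl : forall x y (a : mor x y), comp (idm y) a = a;
  comp_idr : forall x y (a : mor x y), comp a (idm x) = a;
  compA : forall w x y z (c : mor y z) (b : mor x y) (a : mor w x),
    comp c (comp b a) = comp (comp c b) a
}.
Arguments mor {_} x y.
Arguments idm {_} x.
Arguments comp {_ _ _ _} b a : rename.

Notation "b • a" := (comp b a) (at level 40, left associativity) : cat_scope.

Definition is_iso (C : category) (x y : C) (a : mor x y) : Prop :=
  exists b : mor y x, b • a = idm x /\ a • b = idm y.

Definition isomorphic (C : category) (x y : C) : Prop :=
  exists a : mor x y, is_iso a.

Notation "x ≅ y" := (isomorphic x y) (at level 70, no associativity) : cat_scope.

Definition eq_mor (C : category) (x y : C) (p : x = y) : mor x y :=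
  match p in _ = z return mor x z with eq_refl => idm x end.

Record functor (C D : category) := Functor {
  fobj :> C -> D;
  fmap : forall x y, mor x y -> mor (fobj x) (fobj y);
  fmap_id : forall x, fmap (idm x) = idm (fobj x);
  fmap_comp : forall x y z (b : mor y z) (a : mor x y),
    fmap (b • a) = fmap b • fmap a
}.
Arguments fmap {C D} f {x y} a : rename.

Definition fully_faithful (C D : category) (F : functor C D) : Prop :=
  forall (x y : C) (b : mor (F x) (F y)), exists! a : mor x y, fmap F a = b.

Definition functor_id (C : category) : functor C C :=
  @Functor C C (fun x => x) (fun _ _ a => a)
    (fun _ => eq_refl) (fun _ _ _ _ _ => eq_refl).

Definition functor_comp (C D E : category) (G : functor D E) (F : functor C D) :
  functor C E.
Proof.
refine (@Functor C E (fun x => G (F x)) (fun x y a => fmap G (fmap F a)) _ _).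
- intros x; rewrite !fmap_id; reflexivity.
- intros x y z b a; rewrite !fmap_comp; reflexivity.
Defined.

Definition naturally_isomorphic (C D : category) (F G : functor C D) : Prop :=
  exists t : forall x, mor (F x) (G x),
    (forall x, is_iso (t x)) /\
    (forall x y (a : mor x y), t y • fmap F a = fmap G a • t x).

Definition equivalent_categories (C D : category) : Prop :=
  exists (F : functor C D) (G : functor D C),
    naturally_isomorphic (functor_comp G F) (functor_id C) /\
    naturally_isomorphic (functor_comp F G) (functor_id D).

Definition terminal_category : category.
Proof.
refine (@Category unit (fun _ _ => unit) (fun _ => tt) (fun _ _ _ _ _ => tt)
          _ _ _).
- intros x y []; reflexivity.
- intros x y []; reflexivity.
- reflexivity.
Defined.

Definition product_category (C D : category) : category.
Proof.
refine (@Category (C * D)%type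
          (fun x y => (mor (fst x) (fst y) * mor (snd x) (snd y))%type)
          (fun x => (idm (fst x), idm (snd x)))
          (fun x y z b a => (fst b • fst a, snd b • snd a)) _ _ _).
- intros x y [a1 a2]; cbn; rewrite !comp_idl; reflexivity.
- intros x y [a1 a2]; cbn; rewrite !comp_idr; reflexivity.
- intros w x y z c b a; cbn; rewrite !compA; reflexivity.
Defined.

(* A strict 2-category as a category enriched in categories.  The 1-cells
   A -> B are the objects of [hom A B] and the 2-cells its morphisms.  The
   associativity and unit laws are equalities of functors: the laws ending in
   1 give equality on 1-cells, those ending in 2 equality on 2-cells, where
   [eq_mor] identifies 2-cells whose boundaries are only propositionally
   equal. *)
Record two_category := TwoCategory {
  ob :> Type;
  hom : ob -> ob -> category;
  id1 : forall A, hom A A;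
  hcomp : forall A B C,
    functor (product_category (hom B C) (hom A B)) (hom A C);
  comp1 := fun A B C (g : hom B C) (f : hom A B) => hcomp A B C (g, f);
  comp2 := fun A B C (g g' : hom B C) (f f' : hom A B)
               (b : mor g g') (a : mor f f') =>
    (@fmap _ _ (hcomp A B C) (g, f) (g', f') (b, a)
     : mor (comp1 g f) (comp1 g' f'));
  idl1 : forall A B (f : hom A B), comp1 (id1 B) f = f;
  idl2 : forall A B (f f' : hom A B) (a : mor f f'),
    eq_mor (idl1 f') • comp2 (idm (id1 B)) a = a • eq_mor (idl1 f);
  idr1 : forall A B (f : hom A B), comp1 f (id1 A) = f;
  idr2 : forall A B (f f' : hom A B) (a : mor f f'),
    eq_mor (idr1 f') • comp2 a (idm (id1 A)) = a • eq_mor (idr1 f);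
  assoc1 : forall A B C D (h : hom C D) (g : hom B C) (f : hom A B),
    comp1 h (comp1 g f) = comp1 (comp1 h g) f;
  assoc2 : forall A B C D (h h' : hom C D) (g g' : hom B C) (f f' : hom A B)
      (c : mor h h') (b : mor g g') (a : mor f f'),
    eq_mor (assoc1 h' g' f') • comp2 c (comp2 b a) =
    comp2 (comp2 c b) a • eq_mor (assoc1 h g f)
}.
Arguments hom {_} A B : rename.
Arguments id1 {_} A : rename.
Arguments hcomp {_} A B C : rename.
Arguments comp1 {_ A B C} g f : rename.
Arguments comp2 {_ A B C g g' f f'} b a : rename.

Notation "g ∘ f" := (comp1 g f) (at level 40, left associativity) : cat_scope.

Section TwoCategory.
Variable L : two_category.

Definition whisker_l (A B C : L) (g : hom B C) (f f' : hom A B)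
  (a : mor f f') : mor (g ∘ f) (g ∘ f') := comp2 (idm g) a.

Definition whisker_r (A B C : L) (g g' : hom B C) (b : mor g g')
  (f : hom A B) : mor (g ∘ f) (g' ∘ f) := comp2 b (idm f).

Definition postcomp (A B : L) (f : hom A B) (Z : L) :
  functor (hom Z A) (hom Z B).
Proof.
refine (@Functor (hom Z A) (hom Z B) (fun u => f ∘ u)
          (fun u v a => whisker_l f a) _ _).
- intros u; exact (fmap_id (hcomp Z A B) (f, u)).
- intros u v w b a; unfold whisker_l.
  pattern (idm f) at 1; rewrite <- (comp_idl (idm f)).
  exact (@fmap_comp _ _ (hcomp Z A B) (f, u) (f, v) (f, w) (idm f, b) (idm f, a)).
Defined.

Definition precomp (A B : L) (f : hom A B) (Z : L) :
  functor (hom B Z) (hom A Z).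
Proof.
refine (@Functor (hom B Z) (hom A Z) (fun u => u ∘ f)
          (fun u v a => whisker_r a f) _ _).
- intros u; exact (fmap_id (hcomp A B Z) (u, f)).
- intros u v w b a; unfold whisker_r.
  pattern (idm f) at 1; rewrite <- (comp_idl (idm f)).
  exact (@fmap_comp _ _ (hcomp A B Z) (u, f) (v, f) (w, f) (b, idm f) (a, idm f)).
Defined.

Definition two_mono (A B : L) (f : hom A B) : Prop :=
  forall Z : L, fully_faithful (postcomp f Z).

Definition two_epi (A B : L) (f : hom A B) : Prop :=
  forall Z : L, fully_faithful (precomp f Z).

Definition is_equivalence (A B : L) (t : hom A B) : Prop :=
  exists s : hom B A, s ∘ t ≅ id1 A /\ t ∘ s ≅ id1 B.

Definition bizero (zero : L) : Prop :=
  forall A : L,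
    equivalent_categories (hom A zero) terminal_category /\
    equivalent_categories (hom zero A) terminal_category.

Definition null (zero A B : L) (f : hom A B) : Prop :=
  exists (p : hom A zero) (q : hom zero B), f = q ∘ p.

Definition iso_null (zero A B : L) (f : hom A B) : Prop :=
  exists n : hom A B, null zero n /\ f ≅ n.

Definition strong_bizero (zero : L) : Prop :=
  bizero zero /\
  forall (A B : L) (f g : hom A B),
    null zero f -> null zero g -> exists! a : mor f g, True.

Definition two_kernel (zero A B : L) (f : hom A B) (K : L) (k : hom K A) : Prop :=
  iso_null zero (f ∘ k) /\
  (forall (Z : L) (z : hom Z A), iso_null zero (f ∘ z) ->
     exists u : hom Z K, k ∘ u ≅ z) /\
  (forall (Z : L) (u v : hom Z K) (l : mor (k ∘ u) (k ∘ v)),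
     exists! a : mor u v, whisker_l k a = l).

Definition two_cokernel (zero A B : L) (f : hom A B) (C : L) (c : hom B C) : Prop :=
  iso_null zero (c ∘ f) /\
  (forall (Z : L) (z : hom B Z), iso_null zero (z ∘ f) ->
     exists u : hom C Z, u ∘ c ≅ z) /\
  (forall (Z : L) (u v : hom C Z) (l : mor (u ∘ c) (v ∘ c)),
     exists! a : mor u v, whisker_r a c = l).

Definition two_z_exact (zero : L) : Prop :=
  strong_bizero zero /\
  (forall (A B : L) (f : hom A B),
     exists (K : L) (k : hom K A), two_kernel zero f k) /\
  (forall (A B : L) (f : hom A B),
     exists (C : L) (c : hom B C), two_cokernel zero f c).

Definition normal_two_mono (zero A B : L) (m : hom A B) : Prop :=
  exists (C : L) (g : hom B C), two_kernel zero g m.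

Definition normal_two_epi (zero A B : L) (e : hom A B) : Prop :=
  exists (C : L) (g : hom C A), two_cokernel zero g e.

End TwoCategory.

(* Main.v *)
Require Import Defs.
From Stdlib Require Import Setoid Morphisms.

Set Implicit Arguments.
Unset Strict Implicit.
Unset Printing Implicit Defensive.
Local Open Scope cat_scope.

(** Both claims rest on a comparison between a factorisation [m ∘ e] into a
    normal 2-epimorphism and a normal 2-monomorphism and an isomorphic one
    [m' ∘ e'] into a mere 2-epimorphism and a mere 2-monomorphism
    ([factorisation_comparison]).  Say that [e] is a 2-cokernel of [g] and [m]
    a 2-kernel of [h].  A 2-monomorphism reflects null 1-cells up to
    isomorphism, since parallel null 1-cells are isomorphic and it is fully
    faithful on hom-categories ([two_mono_iso_null]).  So from
    [m' ∘ e' ∘ g ≅ m ∘ e ∘ g ≅ 0] follows [e' ∘ g ≅ 0], and the universal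
    property of [e] gives [t] with [t ∘ e ≅ e'].  Dually [h ∘ m' ≅ 0], which
    gives [s] with [m ∘ s ≅ m'].  Cancelling 2-epimorphisms and
    2-monomorphisms yields the remaining triangles and shows that [s] and [t]
    are mutually inverse up to isomorphism.

    Uniqueness is the case where [e'] and [m'] are themselves normal.  In
    general, [e'] is again a 2-cokernel of [g]: a factorisation through [e]
    becomes one through [e'] by composing with [s], and the 2-dimensional part
    of the universal property says exactly that [e'] is a 2-epimorphism.
    Dually for [m'], composing with [t]. *)

(** * Invertible morphisms and 2-cells *)

#[local] Instance isomorphic_equivalence (C : category) :
  Equivalence (@isomorphic C).
Proof.
split.
- intros x; exists (idm x), (idm x); rewrite comp_idl; auto.
- intros x y [a [b [H1 H2]]]; exists b, a; auto.
- intros x y z [a [a' [H1 H2]]] [b [b' [H3 H4]]].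
  exists (b • a), (a' • b'); split.
  + rewrite compA, <- (compA a' b' b), H3, comp_idr; exact H1.
  + rewrite compA, <- (compA b a a'), H2, comp_idr; exact H4.
Qed.

Lemma fobj_isomorphic (C D : category) (F : functor C D) (x y : C) :
  x ≅ y -> F x ≅ F y.
Proof.
intros [a [b [H1 H2]]]; exists (fmap F a), (fmap F b).
rewrite <- !fmap_comp, H1, H2, !fmap_id; auto.
Qed.

Lemma fully_faithful_reflects_isomorphic (C D : category) (F : functor C D)
  (x y : C) : fully_faithful F -> F x ≅ F y -> x ≅ y.
Proof.
intros HF [a [b [H1 H2]]].
destruct (HF _ _ a) as [a' [Ha _]]; destruct (HF _ _ b) as [b' [Hb _]].
exists a', b'; split.
- destruct (HF _ _ (idm (F x))) as [i [_ Hi]].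
  transitivity i; [symmetry|]; apply Hi.
  + rewrite fmap_comp, Ha, Hb; exact H1.
  + apply fmap_id.
- destruct (HF _ _ (idm (F y))) as [i [_ Hi]].
  transitivity i; [symmetry|]; apply Hi.
  + rewrite fmap_comp, Ha, Hb; exact H2.
  + apply fmap_id.
Qed.

#[local] Instance comp1_isomorphic (L : two_category) (A B C : L) :
  Proper (@isomorphic (hom B C) ==> @isomorphic (hom A B) ==>
          @isomorphic (hom A C)) (@comp1 L A B C).
Proof.
intros g g' Hg f f' Hf; transitivity (g ∘ f').
- exact (fobj_isomorphic (postcomp g A) Hf).
- exact (fobj_isomorphic (precomp f' C) Hg).
Qed.

Lemma two_mono_cancel (L : two_category) (A B Z : L) (m : hom A B)
  (u v : hom Z A) : two_mono m -> m ∘ u ≅ m ∘ v -> u ≅ v.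
Proof.
intros Hm; exact (@fully_faithful_reflects_isomorphic _ _ (postcomp m Z) u v (Hm Z)).
Qed.

Lemma two_epi_cancel (L : two_category) (A B Z : L) (e : hom A B)
  (u v : hom B Z) : two_epi e -> u ∘ e ≅ v ∘ e -> u ≅ v.
Proof.
intros He; exact (@fully_faithful_reflects_isomorphic _ _ (precomp e Z) u v (He Z)).
Qed.

(** * Null 1-cells *)

#[local] Instance iso_null_isomorphic (L : two_category) (zero A B : L) :
  Proper (@isomorphic (hom A B) ==> iff) (@iso_null L zero A B).
Proof.
intros f g H; split; intros [n [Hn Hi]]; exists n; split; trivial.
- rewrite <- H; exact Hi.
- rewrite H; exact Hi.
Qed.

Lemma null_comp_l (L : two_category) (zero A B C : L) (g : hom B C)
  (f : hom A B) : null zero f -> null zero (g ∘ f).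
Proof. intros [p [q ->]]; exists p, (g ∘ q); apply assoc1. Qed.

Lemma null_comp_r (L : two_category) (zero A B C : L) (g : hom B C)
  (f : hom A B) : null zero g -> null zero (g ∘ f).
Proof. intros [p [q ->]]; exists (p ∘ f), q; symmetry; apply assoc1. Qed.

Lemma iso_null_comp_l (L : two_category) (zero A B C : L) (g : hom B C)
  (f : hom A B) : iso_null zero f -> iso_null zero (g ∘ f).
Proof.
intros [n [Hn Hi]]; exists (g ∘ n); split.
- apply null_comp_l; exact Hn.
- rewrite Hi; reflexivity.
Qed.

Lemma iso_null_comp_r (L : two_category) (zero A B C : L) (g : hom B C)
  (f : hom A B) : iso_null zero g -> iso_null zero (g ∘ f).
Proof.
intros [n [Hn Hi]]; exists (n ∘ f); split.
- apply null_comp_r; exact Hn.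
- rewrite Hi; reflexivity.
Qed.

Lemma null_exists (L : two_category) (zero A B : L) :
  bizero zero -> exists n : hom A B, null zero n.
Proof.
intros H0.
destruct (H0 A) as [[_ [P _]] _]; destruct (H0 B) as [_ [_ [Q _]]].
exists (Q tt ∘ P tt), (P tt), (Q tt); reflexivity.
Qed.

Lemma null_isomorphic (L : two_category) (zero A B : L) (f g : hom A B) :
  strong_bizero zero -> null zero f -> null zero g -> f ≅ g.
Proof.
intros [_ H] Hf Hg.
destruct (H _ _ f g Hf Hg) as [a _]; destruct (H _ _ g f Hg Hf) as [b _].
exists a, b; split.
- destruct (H _ _ f f Hf Hf) as [i [_ Hi]].
  transitivity i; [symmetry|]; apply Hi; exact Logic.I.
- destruct (H _ _ g g Hg Hg) as [i [_ Hi]].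
  transitivity i; [symmetry|]; apply Hi; exact Logic.I.
Qed.

Lemma two_mono_iso_null (L : two_category) (zero A B Z : L) (m : hom A B)
  (x : hom Z A) :
  strong_bizero zero -> two_mono m -> iso_null zero (m ∘ x) -> iso_null zero x.
Proof.
intros H0 Hm [n [Hn Hi]].
destruct (null_exists Z A (proj1 H0)) as [n' Hn'].
exists n'; split; trivial.
apply (two_mono_cancel Hm); rewrite Hi.
apply (null_isomorphic H0 Hn), null_comp_l, Hn'.
Qed.

Lemma two_epi_iso_null (L : two_category) (zero A B Z : L) (e : hom A B)
  (x : hom B Z) :
  strong_bizero zero -> two_epi e -> iso_null zero (x ∘ e) -> iso_null zero x.
Proof.
intros H0 He [n [Hn Hi]].
destruct (null_exists B Z (proj1 H0)) as [n' Hn'].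
exists n'; split; trivial.
apply (two_epi_cancel He); rewrite Hi.
apply (null_isomorphic H0 Hn), null_comp_r, Hn'.
Qed.

(** * Comparing factorisations *)

Lemma two_kernel_two_mono (L : two_category) (zero A B K : L) (f : hom A B)
  (k : hom K A) : two_kernel zero f k -> two_mono k.
Proof. intros [_ [_ H]]; exact H. Qed.

Lemma two_cokernel_two_epi (L : two_category) (zero A B C : L) (f : hom A B)
  (c : hom B C) : two_cokernel zero f c -> two_epi c.
Proof. intros [_ [_ H]]; exact H. Qed.

Lemma factorisation_comparison (L : two_category) (zero A B G H I I' : L)
  (g : hom G A) (h : hom B H) (e : hom A I) (m : hom I B)
  (e' : hom A I') (m' : hom I' B) :
  strong_bizero zero -> two_cokernel zero g e -> two_kernel zero h m ->
  two_epi e' -> two_mono m' -> m ∘ e ≅ m' ∘ e' ->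
  iso_null zero (e' ∘ g) /\ iso_null zero (h ∘ m') /\
  exists (t : hom I I') (s : hom I' I),
    (t ∘ e ≅ e' /\ m' ∘ t ≅ m) /\ (s ∘ e' ≅ e /\ m ∘ s ≅ m') /\
    (s ∘ t ≅ id1 I /\ t ∘ s ≅ id1 I').
Proof.
intros H0 He Hm Ee' Mm' Hf.
pose proof (two_cokernel_two_epi He) as Ee.
pose proof (two_kernel_two_mono Hm) as Mm.
destruct He as [Heg [Heu _]]; destruct Hm as [Hhm [Hmu _]].
assert (Neg : iso_null zero (e' ∘ g)).
{ apply (two_mono_iso_null H0 Mm').
  rewrite assoc1, <- Hf, <- assoc1; apply iso_null_comp_l, Heg. }
assert (Nhm : iso_null zero (h ∘ m')).
{ apply (two_epi_iso_null H0 Ee').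
  rewrite <- assoc1, <- Hf, assoc1; apply iso_null_comp_r, Hhm. }
destruct (Heu _ _ Neg) as [t Ht]; destruct (Hmu _ _ Nhm) as [s Hs].
assert (Hse : s ∘ e' ≅ e).
{ apply (two_mono_cancel Mm); rewrite assoc1, Hs, Hf; reflexivity. }
assert (Hmt : m' ∘ t ≅ m).
{ apply (two_epi_cancel Ee); rewrite <- assoc1, Ht, Hf; reflexivity. }
split; [exact Neg|split; [exact Nhm|]].
exists t, s; repeat split; trivial.
- apply (two_epi_cancel Ee); rewrite <- assoc1, Ht, Hse, idl1; reflexivity.
- apply (two_epi_cancel Ee'); rewrite <- assoc1, Hse, Ht, idl1; reflexivity.
Qed.

Theorem proposition3p22 (L : two_category) (zero : L) (HL : two_z_exact zero)
  (A B : L) (f : hom A B)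
  (I : L) (e : hom A I) (m : hom I B)
  (He : normal_two_epi zero e) (Hm : normal_two_mono zero m) (Hf : f ≅ m ∘ e) :
  (forall (I1 : L) (e1 : hom A I1) (m1 : hom I1 B),
     normal_two_epi zero e1 -> normal_two_mono zero m1 -> f ≅ m1 ∘ e1 ->
     exists t : hom I I1, is_equivalence t /\ t ∘ e ≅ e1 /\ m1 ∘ t ≅ m) /\
  (forall (I' : L) (e' : hom A I') (m' : hom I' B),
     two_epi e' -> two_mono m' -> f ≅ m' ∘ e' ->
     normal_two_epi zero e' /\ normal_two_mono zero m').
Proof.
destruct HL as [H0 _]; destruct He as [G [g He]]; destruct Hm as [H [h Hm]].
split.
- intros I1 e1 m1 [G1 [g1 He1]] [H1 [h1 Hm1]] Hf1.
  rewrite Hf in Hf1.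
  destruct (factorisation_comparison H0 He Hm (two_cokernel_two_epi He1)
              (two_kernel_two_mono Hm1) Hf1)
    as [_ [_ [t [s [Ht [_ Hts]]]]]].
  exists t; split; [exists s; exact Hts|exact Ht].
- intros I' e' m' Ee' Mm' Hf'.
  rewrite Hf in Hf'.
  destruct (factorisation_comparison H0 He Hm Ee' Mm' Hf')
    as [Neg [Nhm [t [s [[_ Hmt] [[Hse _] _]]]]]].
  split.
  + exists G, g; split; [exact Neg|split; [|exact Ee']].
    intros Z z Hz; destruct He as [_ [Heu _]].
    destruct (Heu _ _ Hz) as [u Hu]; exists (u ∘ s).
    rewrite <- assoc1, Hse; exact Hu.
  + exists H, h; split; [exact Nhm|split; [|exact Mm']].
    intros Z z Hz; destruct Hm as [_ [Hmu _]].
    destruct (Hmu _ _ Hz) as [u Hu]; exists (t ∘ u).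
    rewrite assoc1, Hmt; exact Hu.
Qed.
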